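(* For $n\geq 0$, $$F_{2n+1}^I(x,y,q)=\sum_{j=0}^{n}x\,y^j q^{4nj-2j^2+2n-2j}F_{2n-2j}^I(x,y,q).$$
   Context: $S_n(123,132,213)$ is the set of permutations of $[n]$ with no subsequence order isomorphic to $123$, $132$ or $213$; each such $\pi$ is a concatenation of increasing blocks of size $1$ or $2$, each block larger than all later blocks. $s(\pi)$, $d(\pi)$ are the numbers of maximal increasing runs of $\pi$ of length $1$ and $2$, and $inv(\pi)$ is the number of inversions. $F_n^I(x,y,q)=\sum_{\pi\in S_n(123,132,213)}x^{s(\pi)}y^{d(\pi)}q^{inv(\pi)}$ (so $F_0^I=1$). *)

(* Defs.v *)
From mathcomp Require Import all_boot all_order all_fingroup all_algebra.

Set Implicit Arguments.
Unset Strict Implicit.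
Unset Printing Implicit Defensive.

Import GRing.Theory.

(* Permutations of [n] = {1, .., n} are represented by 'S_n, acting on
   {0, .., n-1}; [word] is the usual one-line notation pi(1) .. pi(n). *)
Definition word (n : nat) (pi : 'S_n) : seq nat :=
  [seq (pi i : nat).+1 | i <- enum 'I_n].

Definition order_iso (u v : seq nat) : bool :=
  (size u == size v) &&
  [forall i : 'I_(size u), forall j : 'I_(size u),
     (nth 0 u i < nth 0 u j) == (nth 0 v i < nth 0 v j)].

(* The subsequences of a word of length n are its masks by n.-tuples of
   booleans. *)
Definition avoids (n : nat) (pi : 'S_n) (p : seq nat) : bool :=
  [forall m : n.-tuple bool, ~~ order_iso (mask m (word pi)) p].

Definition avoiders (n : nat) : {set 'S_n} :=
  [set pi | [&& avoids pi [:: 1; 2; 3], avoids pi [:: 1; 3; 2]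
              & avoids pi [:: 2; 1; 3]]].

(* The factor of w of length k starting at (0-based) position i is increasing
   and cannot be extended to a longer increasing factor on either side. *)
Definition maximal_run (w : seq nat) (i k : nat) : bool :=
  [&& 0 < k, i + k <= size w, sorted ltn (take k (drop i w)),
      (0 < i) ==> ~~ (nth 0 w i.-1 < nth 0 w i)
    & (i + k < size w) ==> ~~ (nth 0 w (i + k).-1 < nth 0 w (i + k))].

Definition nb_runs (k n : nat) (pi : 'S_n) : nat :=
  #|[set i : 'I_n | maximal_run (word pi) i k]|.

Definition s_stat (n : nat) (pi : 'S_n) : nat := nb_runs 1 pi.
Definition d_stat (n : nat) (pi : 'S_n) : nat := nb_runs 2 pi.

Definition inv_stat (n : nat) (pi : 'S_n) : nat :=
  #|[set ij : 'I_n * 'I_n | (ij.1 < ij.2) && (pi ij.2 < pi ij.1)]|.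

Local Open Scope ring_scope.

(* x, y, q range over an arbitrary commutative ring; taking them to be the
   variables of a polynomial ring over the integers gives the generating
   polynomial itself. *)
Definition FI (R : comNzRingType) (n : nat) (x y q : R) : R :=
  \sum_(pi in avoiders n) x ^+ s_stat pi * y ^+ d_stat pi * q ^+ inv_stat pi.

(* Main.v *)
(** Avoiding 123, 132 and 213 means exactly that every subsequence [a b c]
    satisfies [c < a], i.e. that every letter exceeds all letters at least two
    places to its right.  Hence a nonempty avoider starts either with its
    maximum or with its two largest letters in increasing order, and removing
    this first run leaves an arbitrary shorter avoider.  This gives
    [F_(m+2) = x q^(m+1) F_(m+1) + y q^(2m) F_m], and iterating it on the
    second term, starting from [F_(2n+1)], gives the identity. *)
Require Import Defs.
From mathcomp Require Import all_boot all_order all_fingroup all_algebra.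
From mathcomp Require Import zify ring.

Set Implicit Arguments.
Unset Strict Implicit.
Unset Printing Implicit Defensive.

Import GRing.Theory.

(** * One-line words as rearrangements of 1, .., n *)

Lemma size_word n (pi : 'S_n) : size (word pi) = n.
Proof. by rewrite size_map size_enum_ord. Qed.

Lemma nth_word n (pi : 'S_n) (i : 'I_n) : nth 0 (word pi) i = (pi i).+1.
Proof. by rewrite (nth_map i) ?size_enum_ord // nth_ord_enum. Qed.

Lemma word_inj n : injective (@word n).
Proof.
move=> p1 p2 eq_w; apply/permP => i; apply/val_inj/succn_inj.
by rewrite -!nth_word eq_w.
Qed.

Lemma word_permP n (w : seq nat) :
  reflect (exists pi : 'S_n, w = word pi) (perm_eq w (iota 1 n)).
Proof.
pose t := [tuple (i : nat).+1 | i < n].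
have -> : iota 1 n = t.
  by rewrite -(addn0 1) iotaDl -val_enum_ord -map_comp.
have wordE (pi : 'S_n) : [tuple tnth t (pi i) | i < n] = word pi :> seq nat.
  by apply: eq_map => i; rewrite tnth_mktuple.
by apply: (iffP tuple_permP) => -[pi ->]; exists pi; rewrite wordE.
Qed.

(** * The three patterns as one condition on triples *)

Fixpoint far_decreasing (w : seq nat) : bool :=
  if w is a :: w' then all (gtn a) (behead w') && far_decreasing w' else true.

(** A triple starting at a letter can only end at least two places further right; conversely, for
    each such end the immediate successor of the first letter serves as [b]. *)
Lemma far_decreasingP (w : seq nat) :
  reflect (forall a b c, subseq [:: a; b; c] w -> c < a) (far_decreasing w).
Proof.
elim: w => [|d w IHw] /=; first by left.
apply: (iffP andP) => [[/allP lt_d /IHw lt_w] a b c | lt_dw].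
  case: eqP => [-> | _]; last exact: lt_w.
  case: w lt_d {lt_w IHw} => [|e w] //= lt_d.
  case: eqP => _ sub_w; apply: lt_d; first by rewrite -sub1seq.
  by apply: (mem_subseq sub_w); rewrite !inE eqxx orbT.
split; last first.
  apply/IHw => a b c sub_w; apply: (lt_dw a b c).
  by case: eqP => // _; apply: subseq_trans sub_w; exact: subseq_cons.
apply/allP => c; case: w lt_dw {IHw} => [|e w] //= lt_dw c_w.
by apply: (lt_dw d e c); rewrite !eqxx sub1seq.
Qed.

Lemma forall_ord3 (P : pred nat) :
  [forall i : 'I_3, P i] = [&& P 0, P 1 & P 2].
Proof.
rewrite -(big_andE predT (fun i : 'I_3 => P i)) !big_ord_recl big_ord0.
by rewrite andbT.
Qed.

Lemma order_iso3E a b c p1 p2 p3 :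
  order_iso [:: a; b; c] [:: p1; p2; p3] =
  [&& (a < b) == (p1 < p2), (a < c) == (p1 < p3), (b < a) == (p2 < p1),
      (b < c) == (p2 < p3), (c < a) == (p3 < p1) & (c < b) == (p3 < p2)].
Proof.
pose P i := [forall j : 'I_3, (nth 0 [:: a; b; c] i < nth 0 [:: a; b; c] j) ==
  (nth 0 [:: p1; p2; p3] i < nth 0 [:: p1; p2; p3] j)].
rewrite /order_iso /= (forall_ord3 P) /P.
do 3 rewrite (forall_ord3 (fun j => (nth 0 _ _ < nth 0 _ j) == (nth 0 _ _ < nth 0 _ j))).
by rewrite /= !ltnn !eqxx /= !andbA ?andbT.
Qed.

Lemma avoids3P n (pi : 'S_n) p1 p2 p3 :
  reflect (forall a b c, subseq [:: a; b; c] (word pi) ->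
             ~~ order_iso [:: a; b; c] [:: p1; p2; p3])
          (avoids pi [:: p1; p2; p3]).
Proof.
apply: (iffP forallP) => [av a b c /subseqP [m sz_m ->] | av m].
  by rewrite size_word in sz_m; have := av (Tuple (introT eqP sz_m)).
have := mask_subseq m (word pi).
(* A mask that does not keep exactly three letters fails the size test of [order_iso]. *)
case: (mask m (word pi)) => [|a [|b [|c [|d s]]]] //; exact: av.
Qed.

(** Of the six orders of three distinct letters [a b c], the forbidden 123, 132 and 213 are exactly
    those with [a < c]. *)
Lemma mem_avoiders n (pi : 'S_n) :
  (pi \in avoiders n) = far_decreasing (word pi).
Proof.
have uniq_pi : uniq (word pi).
  by rewrite map_inj_uniq ?enum_uniq // => i j [] /val_inj /perm_inj.
rewrite inE; apply/and3P/far_decreasingP.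
  move=> [/avoids3P av1 /avoids3P av2 /avoids3P av3] a b c sub.
  move: (av1 _ _ _ sub) (av2 _ _ _ sub) (av3 _ _ _ sub) (subseq_uniq sub uniq_pi).
  by rewrite !order_iso3E /= !inE; lia.
by move=> dec; split; apply/avoids3P => a b c /dec; rewrite order_iso3E; lia.
Qed.

(** * An explicit list of the avoiding words, by first run *)

Fixpoint layered (n : nat) : seq (seq nat) :=
  if n is m.+1 then
    map (cons n) (layered m) ++
    (if m is k.+1 then map (fun w => [:: m, n & w]) (layered k) else [::])
  else [:: [::]].

Lemma layeredSS n :
  layered n.+2 = map (cons n.+2) (layered n.+1) ++
                 map (fun w => [:: n.+1, n.+2 & w]) (layered n).
Proof. by []. Qed.

Lemma nat_ind2 (P : nat -> Prop) :
  P 0 -> P 1 -> (forall n, P n -> P n.+1 -> P n.+2) -> forall n, P n.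
Proof.
by move=> P0 P1 PSS n; suff [] : P n /\ P n.+1 by []; elim: n => // n [] *; auto.
Qed.

Lemma layered_uniq n : uniq (layered n).
Proof.
elim/nat_ind2: n => // n IHn IHn1; rewrite layeredSS cat_uniq.
rewrite !map_inj_uniq ?IHn ?IHn1 ?andbT => [|w1 w2 [] //|w1 w2 [] //].
(* The two families are disjoint: one starts with [n.+2], the other with [n.+1]. *)
apply/hasPn => _ /mapP [w _ ->]; apply/mapP => -[w' _ [] /eqP].
by lia.
Qed.

Lemma perm_iotaS m n : perm_eq (iota m n.+1) (m + n :: iota m n).
Proof. by rewrite -addn1 iotaD cats1 perm_rcons. Qed.

Lemma mem_layered n w :
  (w \in layered n) = perm_eq w (iota 1 n) && far_decreasing w.
Proof.
have lt_iota m v : perm_eq v (iota 1 m) -> all (gtn m.+1) v.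
  by move=> /perm_mem v_eq; apply/allP => c; rewrite v_eq mem_iota => /andP [].
elim/nat_ind2: n w => [w|w|n IHn IHn1 w].
- by rewrite inE; case: w => [|a w] //=; apply/esym/andP => -[/perm_size].
- rewrite inE; apply/eqP/andP => [-> //|[perm_w _]].
  by have /perm_small_eq-> := perm_w.
rewrite layeredSS mem_cat; apply/orP/andP => [[]|[perm_w dec_w]].
- case/mapP => v; rewrite IHn1 => /andP [perm_v dec_v] ->; split.
    by rewrite (permPr (perm_iotaS 1 n.+1)) perm_cons.
  rewrite /= dec_v andbT; have := lt_iota _ _ perm_v.
  by case: (v) => //= a v' /andP [].
- case/mapP => v; rewrite IHn => /andP [perm_v dec_v] ->; split.
    rewrite (permPr (perm_iotaS 1 n.+1)) (perm_catCA [:: _] [:: _] v) perm_cons.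
    by rewrite (permPr (perm_iotaS 1 n)) perm_cons.
  have lt_v := lt_iota _ _ perm_v; rewrite /= dec_v lt_v andbT /=.
  case: (v) lt_v => //= a v' /andP [_ /allP lt_v]; apply/allP => c /lt_v /=.
  by lia.
have := perm_size perm_w; rewrite size_iota.
case: w perm_w dec_w => [|a [|b w]] // perm_w.
have w_mem := perm_mem perm_w; rewrite [far_decreasing _]/=.
case/andP => /allP /= lt_a dec_w _.
(* The maximum [n.+2] is one of the first two letters, since inside [w] it would have to be smaller
   than [a]. *)
have: n.+2 \in [:: a, b & w] by rewrite w_mem mem_iota; lia.
have le_a : a < n.+3.
  by have := w_mem a; rewrite mem_head mem_iota => /esym; lia.
rewrite !inE => /or3P [/eqP def_a|/eqP def_b|/lt_a /=]; last by lia.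
- left; rewrite def_a; apply: map_f.
  rewrite IHn1 [far_decreasing (b :: w)]dec_w andbT.
  by move: perm_w; rewrite -def_a (permPr (perm_iotaS 1 n.+1)) perm_cons.
(* If [n.+1] occurred in [w], then [a] would exceed it and so equal [n.+2], which is already [b]. *)
right; have def_a : a = n.+1.
  have := perm_uniq perm_w; rewrite iota_uniq /= inE -def_b.
  have: n.+1 \in [:: a, b & w] by rewrite w_mem mem_iota; lia.
  rewrite !inE => /or3P [/eqP //||/lt_a /=]; last by case: eqP; lia.
  by lia.
subst a b; apply/mapP; exists w => //; rewrite IHn.
case/andP: dec_w => _ ->; rewrite andbT.
move: perm_w; rewrite (permPr (perm_iotaS 1 n.+1)).
rewrite (perm_catCA [:: _] [:: _] w) perm_cons.
by rewrite (permPr (perm_iotaS 1 n)) perm_cons.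
Qed.

Lemma perm_words_avoiders n :
  perm_eq [seq word pi | pi <- enum (avoiders n)] (layered n).
Proof.
apply: uniq_perm; first by rewrite (map_inj_uniq (@word_inj n)) enum_uniq.
  exact: layered_uniq.
move=> w; rewrite mem_layered; apply/mapP/andP => [[pi]|[/word_permP [pi ->] dec]].
  by rewrite mem_enum mem_avoiders => dec ->; split=> //; apply/word_permP; exists pi.
by exists pi; rewrite ?mem_enum ?mem_avoiders.
Qed.

(** * Runs and inversions of words *)

Definition runs (k : nat) (w : seq nat) : nat :=
  count (fun i => maximal_run w i k) (iota 0 (size w)).

Definition invs (w : seq nat) : nat :=
  \sum_(0 <= i < size w) \sum_(0 <= j < size w)
     ((i < j) && (nth 0 w j < nth 0 w i)).

Lemma nb_runsE k n (pi : 'S_n) : nb_runs k pi = runs k (word pi).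
Proof.
rewrite /nb_runs /runs size_word cardsE cardE size_filter -val_enum_ord.
by rewrite count_map enumT.
Qed.

Lemma inv_statE n (pi : 'S_n) : inv_stat pi = invs (word pi).
Proof.
rewrite /inv_stat /invs size_word big_mkord -sum1_card big_mkcond.
rewrite (eq_bigr (fun ij : 'I_n * 'I_n =>
  (ij.1 < ij.2) && (pi ij.2 < pi ij.1) : nat)); last first.
  by move=> ij _; rewrite inE; case: ifP.
rewrite -(pair_bigA _ (fun i j : 'I_n => (i < j) && (pi j < pi i) : nat)) /=.
by apply: eq_bigr => i _; rewrite big_mkord; apply: eq_bigr => j _; rewrite !nth_word.
Qed.

(** Prepending [a] can only affect the test for extension to the left at position 0, and a letter at
    least as large as the old head leaves that test passed. For empty [w] the default 0 makes the
    comparison true. *)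
Lemma maximal_run_cons a w i k :
  (0 < i) || (nth 0 w 0 <= a) ->
  maximal_run (a :: w) i.+1 k = maximal_run w i k.
Proof.
rewrite /maximal_run /= addSn ltnS.
by case: i => [|i] /= le_a; case: k => [|k] //; rewrite -?leqNgt ?le_a ?addnS.
Qed.

Lemma runs_cons k a w :
  runs k (a :: w) = maximal_run (a :: w) 0 k +
                    count (fun i => maximal_run (a :: w) i.+1 k) (iota 0 (size w)).
Proof. by rewrite /runs /= (iotaDl 1 0) count_map. Qed.

Lemma head_le a w : all (gtn a) w -> nth 0 w 0 <= a.
Proof. by case: w => //= b w /andP [/ltnW]. Qed.

Lemma runs_cons1 k a w : all (gtn a) w -> runs k (a :: w) = (k == 1) + runs k w.
Proof.
move=> /head_le le_a; rewrite runs_cons; congr (_ + _).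
  rewrite /maximal_run; case: k => [|[|k]] //=; first by rewrite take0 -leqNgt le_a implybT.
  by case: w le_a => [|b w] //= le_a; rewrite [a < b]ltnNge le_a !andbF.
by rewrite /runs; apply: eq_count => i; rewrite maximal_run_cons ?le_a ?orbT.
Qed.

Lemma runs_cons2 k a b w :
  a < b -> all (gtn a) w -> runs k [:: a, b & w] = (k == 2) + runs k w.
Proof.
move=> lt_ab lt_wa; have le_wb : nth 0 w 0 <= b.
  exact: leq_trans (head_le lt_wa) (ltnW lt_ab).
rewrite runs_cons /= (iotaDl 1 0) count_map; congr (_ + _).
  rewrite /maximal_run; case: k => [|[|[|k]]] //=; rewrite lt_ab //=.
    by rewrite take0 -leqNgt le_wb implybT.
  by case: w le_wb {lt_wa} => [|c w] //= le_cb; rewrite [b < c]ltnNge le_cb !andbF.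
(* No maximal run starts at [b], because [a < b] extends it to the left. *)
rewrite {1}/maximal_run /= lt_ab !andbF add0n.
by apply: eq_count => i; rewrite /= !maximal_run_cons ?le_wb ?orbT.
Qed.

Lemma invs_cons a w : invs (a :: w) = count (gtn a) w + invs w.
Proof.
rewrite /invs /= big_nat_recl // big_nat_recl //= add0n; congr (_ + _).
  (* Writing [w] as the sequence of its entries turns the count over letters into the sum over
     positions paired with the new first one. *)
  rewrite -[w in RHS](mkseq_nth 0) count_map -sum1_count [RHS]big_mkcond /=.
  by rewrite /index_iota subn0; apply: eq_bigr => i _; case: ifP.
by apply: eq_bigr => i _; rewrite big_nat_recl.
Qed.

Local Open Scope ring_scope.

Definition weight (R : comNzRingType) (x y q : R) (w : seq nat) : R :=
  x ^+ runs 1 w * y ^+ runs 2 w * q ^+ invs w.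

Lemma FI_layered (R : comNzRingType) (x y q : R) n :
  FI n x y q = \sum_(w <- layered n) weight x y q w.
Proof.
rewrite -(perm_big _ (perm_words_avoiders n)) big_map big_enum /=.
by apply: eq_bigr => pi _; rewrite /weight -!nb_runsE -inv_statE.
Qed.

Lemma FI0 (R : comNzRingType) (x y q : R) : FI 0 x y q = 1.
Proof. by rewrite FI_layered big_seq1 /weight /invs big_nil !mulr1. Qed.

Lemma FI1 (R : comNzRingType) (x y q : R) : FI 1 x y q = x.
Proof.
by rewrite FI_layered big_seq1 /weight invs_cons !runs_cons1 // /invs big_nil !mulr1.
Qed.

Lemma layered_lt n w : w \in layered n -> size w = n /\ all (gtn n.+1) w.
Proof.
rewrite mem_layered => /andP [perm_w _]; split.
  by rewrite (perm_size perm_w) size_iota.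
by apply/allP => c; rewrite (perm_mem perm_w) mem_iota => /andP [].
Qed.

(** A first run of length 1 forms an inversion with each of the [m.+1] later letters. In a first run
    of length 2 both letters do so with each of the [m] later ones, but not with each other. *)
Lemma FI_rec (R : comNzRingType) (x y q : R) m :
  FI m.+2 x y q = x * q ^+ m.+1 * FI m.+1 x y q + y * q ^+ (2 * m) * FI m x y q.
Proof.
rewrite !FI_layered layeredSS big_cat !big_map !big_distrr.
congr (_ + _); apply: eq_big_seq => w /layered_lt [size_w lt_w]; rewrite /weight.
  rewrite invs_cons !runs_cons1 // (eqP (etrans (esym (all_count _ _)) lt_w)).
  by rewrite size_w /= add0n add1n exprS exprD; ring.
have lt_w' : all (gtn m.+2) w by apply: sub_all lt_w => c /=; lia.
rewrite !invs_cons !runs_cons2 //=.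
move: lt_w lt_w'; rewrite !all_count => /eqP -> /eqP ->.
(* [leqnSn] cancels the pair inside the first run, which is not an inversion. *)
rewrite size_w ltnNge leqnSn /= !add0n add1n exprS addnA addnn -mul2n exprD.
by ring.
Qed.

Theorem theorem4p5 (R : comNzRingType) (x y q : R) (n : nat) :
  FI (2 * n + 1) x y q =
  \sum_(0 <= j < n.+1)
     x * y ^+ j * q ^+ (4 * n * j - 2 * j ^ 2 + 2 * n - 2 * j)%N
       * FI (2 * n - 2 * j) x y q.
Proof.
elim: n => [|n IHn].
  by rewrite big_nat1 FI0 FI1 !mulr1.
have -> : (2 * n.+1 + 1 = (2 * n).+3)%N by lia.
(* The first term of the recurrence is the summand [j = 0]; the second is
   [y * q ^+ (2 * (2 * n + 1))] times the induction hypothesis, giving the summands [j.+1]. *)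
rewrite FI_rec -[(2 * n).+1]addn1 IHn [RHS]big_nat_recl // [X in _ + X = _]big_distrr /=.
congr (_ + _).
  rewrite expr0 !mulr1 (_ : (2 * n.+1 - 2 * 0 = (2 * n + 1).+1)%N); last by lia.
  by congr (_ * _ * _); congr (q ^+ _); lia.
apply: eq_big_nat => j /andP [_ lt_jn].
have -> : (2 * n.+1 - 2 * j.+1 = 2 * n - 2 * j)%N by lia.
(* Since [j <= n], the subtractions in these exponents are not truncated. *)
have -> : (4 * n.+1 * j.+1 - 2 * j.+1 ^ 2 + 2 * n.+1 - 2 * j.+1 =
           2 * (2 * n + 1) + (4 * n * j - 2 * j ^ 2 + 2 * n - 2 * j))%N by nia.
by rewrite exprD exprS; ring.
Qed.
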